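(* Let $\mathbb{X},\mathbb{Y}$ be Banach spaces, $g:\mathbb{X}\to\mathbb{Y}$ continuously differentiable and $f:\mathbb{Y}\to\mathbb{R}\cup\{+\infty\}$ proper, lower semicontinuous and convex. Let $S_f:=\{y\in\mathbb{Y}:f(y)\le0\}$ and $\mathcal{S}:=\{x\in\mathbb{X}:f(g(x))\le0\}$, and assume ${\rm bd}(S_f)\subseteq f^{-1}(0)$. Let $\bar x\in\mathcal{S}$ be such that $g(\bar x)\in{\rm int}({\rm dom} f)$ and $g$ is metrically regular around $\bar x$. Then the inequality $(f\circ g)(x)\le0$ has a local error bound at $\bar x$ if and only if $$\limsup_{x\xrightarrow{{\rm bd}(\mathcal{S})}\bar x}\mathbf{e}\Big(\{h\in\mathbb{X}:\mathbf{d}^+f(g(x),\nabla g(x)(h))\le1\},\ \nabla g(x)^{-1}\big(\mathbf{T}^{\mathbf B}(S_f,g(x))\big)\Big)<+\infty.$$ Moreover, $$\tau(\mathcal{S},\bar x)=\limsup_{x\xrightarrow{{\rm bd}(\mathcal{S})}\bar x}\mathbf{e}\Big(\{h\in\mathbb{X}:\mathbf{d}^+f(g(x),\nabla g(x)(h))\le1\},\ \nabla g(x)^{-1}\big(\mathbf{T}^{\mathbf B}(S_f,g(x))\big)\Big).$$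
   Context: $\mathbf{B}(a,\delta)$ is the open ball with center $a$ and radius $\delta$; ${\rm bd}$, ${\rm int}$ denote boundary and interior; ${\rm dom} f=\{y:f(y)<+\infty\}$; $\mathbf{d}(x,D):=\inf\{\|x-y\|:y\in D\}$. Excess: $\mathbf{e}(C,D):=\sup_{x\in C}\mathbf{d}(x,D)$, with $\mathbf{e}(\emptyset,D)=0$ if $D\ne\emptyset$ and $=\infty$ otherwise. For convex $f$, $\mathbf{d}^+f(y,v):=\lim_{t\to0^+}\frac{f(y+tv)-f(y)}{t}$. Bouligand tangent cone $\mathbf{T}^{\mathbf B}(C,c)$: all $v$ with $v_n\to v$, $t_n\downarrow0$, $c+t_nv_n\in C$. ''Continuously differentiable'' means Fréchet differentiable with $x\mapsto\nabla g(x)$ continuous in operator norm. $g$ is metrically regular around $\bar x$ if there exist $\kappa>0$ and neighborhoods $U$ of $\bar x$, $V$ of $g(\bar x)$ with $\mathbf{d}(x,g^{-1}(y))\le\kappa\|g(x)-y\|$ for all $(x,y)\in U\times V$. Local error bound at $\bar x$: there exist $\tau,\delta>0$ with $\mathbf{d}(x,\mathcal{S})\le\tau\max\{f(g(x)),0\}$ for all $x\in\mathbf{B}(\bar x,\delta)$; $\tau(\mathcal{S},\bar x)$ is the infimum of all $\tau>0$ for which such a $\delta$ exists (with $\inf\emptyset=+\infty$). $\limsup_{x\xrightarrow{D}\bar x}F(x):=\lim_{\delta\downarrow0}\sup\{F(x):x\in D\cap\mathbf{B}(\bar x,\delta)\}$, with the convention $\sup\emptyset=0$. *)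

(* Defs.v *)
From HB Require Import structures.
From mathcomp Require Import all_boot all_order all_algebra.
From mathcomp Require Import all_classical all_reals all_analysis.
Set Implicit Arguments. Unset Strict Implicit. Unset Printing Implicit Defensive.
Import Order.TTheory GRing.Theory Num.Theory.
Import numFieldNormedType.Exports.
Local Open Scope classical_set_scope.
Local Open Scope ring_scope.

Section Defs.
Context {R : realType}.

Definition bdry {T : topologicalType} (A : set T) : set T :=
  closure A `\` interior A.

Definition edom {Y : Type} (f : Y -> \bar R) : set Y := [set y | (f y < +oo)%E].

Definition proper_fun {Y : Type} (f : Y -> \bar R) : Prop :=
  (exists y, (f y < +oo)%E) /\ (forall y, (-oo < f y)%E).

Definition econvex {Y : normedModType R} (f : Y -> \bar R) : Prop :=
  forall (a b : Y) (t : R), 0 < t < 1 ->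
    (f (t *: a + (1 - t) *: b)%R <= t%:E * f a + (1 - t)%:E * f b)%E.

(* distance to a set: inf over D (inf of empty = +oo) *)
Definition edist {X : normedModType R} (x : X) (D : set X) : \bar R :=
  ereal_inf [set (`|x - y|)%:E | y in D].

Definition excess {X : normedModType R} (C D : set X) : \bar R :=
  if C == set0 then (if D == set0 then +oo%E else 0%E)
  else ereal_sup [set edist x D | x in C].

Definition dplus {Y : normedModType R} (f : Y -> \bar R) (y v : Y) : \bar R :=
  lim ((fun t : R => ((f (y + t *: v)%R - f y) * (t^-1)%:E)%E) @ 0^'+).

Definition bouligand {Y : normedModType R} (C : set Y) (c : Y) : set Y :=
  [set v | exists (vn : Y ^nat) (tn : R ^nat),
      vn @ \oo --> v /\ tn @ \oo --> 0 /\ (forall n, 0 < tn n) /\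
      (forall n, C (c + tn n *: vn n))].

Definition C1 {X Y : normedModType R} (g : X -> Y) : Prop :=
  (forall x, differentiable g x) /\
  (forall x0 (eps : R), 0 < eps -> \forall x \near x0,
      forall h, `|'d g x h - 'd g x0 h| <= eps * `|h|).

Definition metric_regular {X Y : normedModType R} (g : X -> Y) (xbar : X) : Prop :=
  exists kappa : R, 0 < kappa /\ exists U V, nbhs xbar U /\ nbhs (g xbar) V /\
    forall x y, U x -> V y ->
      (edist x (g @^-1` [set y]) <= (kappa * `|g x - y|)%:E)%E.

Definition error_bound_with {X Y : normedModType R} (f : Y -> \bar R) (g : X -> Y)
    (xbar : X) (tau : R) : Prop :=
  exists delta : R, 0 < delta /\ forall x, ball xbar delta x ->
    (edist x [set z | (f (g z) <= 0)%E] <= tau%:E * maxe (f (g x)) 0)%E.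

Definition local_error_bound {X Y : normedModType R} (f : Y -> \bar R) (g : X -> Y)
    (xbar : X) : Prop :=
  exists tau : R, 0 < tau /\ error_bound_with f g xbar tau.

(* tau(S, xbar): infimum of admissible tau (inf of empty = +oo) *)
Definition eb_modulus {X Y : normedModType R} (f : Y -> \bar R) (g : X -> Y)
    (xbar : X) : \bar R :=
  ereal_inf [set tau%:E | tau in [set tau : R | 0 < tau /\ error_bound_with f g xbar tau]].

Definition sup0 (A : set (\bar R)) : \bar R :=
  if A == set0 then 0%E else ereal_sup A.

Definition limsup_in {X : normedModType R} (F : X -> \bar R) (D : set X) (xbar : X)
    : \bar R :=
  lim ((fun delta : R => sup0 [set F x | x in D `&` ball xbar delta]) @ 0^'+).

End Defs.

(* Main.v *)
(** Write [S] for the solution set, [A x] for ['d g x] and [T x] for the tangent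
    cone of [f <= 0] at [g x].

    If [g] is metrically regular near [x], then [g s = g x + t *: v] is solvable
    within [o(t)] of [x + t *: h] for [v] close to [A x h]; with completeness of
    [X] (Graves' iteration), [A x] is itself regular, with a constant uniform in
    [x] near [xbar]. Tangent directions in [Y] thus lift to [X], and no
    continuity of [f] is needed.

    [L <= tau]: if [d+ f (g x) (A x h) <= 1], solve [g q = g x + t *: A x h]
    with [q] within [o(t)] of [x + t *: h]. The error bound gives [s] in [S]
    within [tau t + o(t)] of [q]. By convexity [g s - g x] is tangent, and
    regularity of [A x] turns [s - x] into a vector of [(A x)^-1 (T x)], whose
    quotient by [t] is within [tau + o(1)] of [h].

    [tau <= L]: for [x] outside [S], Ekeland's principle for [`|x - .|] on [S]
    yields [z] in the boundary of [S] such that [x - z] is at distance at least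
    [(1 - theta) `|x - z|] of the tangent cone of [S] at [z], which contains
    [(A z)^-1 (T z)]. Correct [x - z] to a nearby [h] with
    [A z h = g x - g z]. Convexity gives [d+ f (g z) (A z h) <= f (g x)], so [h]
    is at distance at most [L f (g x)] of [(A z)^-1 (T z)]. *)

From mathcomp Require Import all_boot all_order all_algebra.
From mathcomp Require Import all_classical all_reals all_analysis.
From mathcomp Require Import ring lra.
(* Imported last: [edist] and [sup0] are also names of MathComp-Analysis. *)
Require Import Defs.
Set Implicit Arguments.
Unset Strict Implicit.
Unset Printing Implicit Defensive.
Import Order.TTheory GRing.Theory Num.Theory.
Import numFieldNormedType.Exports.
Local Open Scope classical_set_scope.
Local Open Scope ring_scope.

Definition sublevel {R : realType} {T : Type} (f : T -> \bar R) (c : \bar R) :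
    set T :=
  [set x | (f x <= c)%E].

Section LowerSemicontinuity.
Context {R : realType} {T : topologicalType}.
Implicit Types phi psi : T -> R.

Lemma sublevel_closed (f : T -> \bar R) (c : R) :
  lower_semicontinuous f -> closed (sublevel f c%:E).
Proof.
move=> /lower_semicontinuousP/(_ c) f_open.
have -> : sublevel f c%:E = ~` [set x | (c%:E < f x)%E].
  by apply/seteqP; split=> x; rewrite /sublevel /= leNgt => /negP.
exact: open_closedC.
Qed.

Lemma continuous_lower_semicontinuous phi :
  continuous phi -> lower_semicontinuous (EFin \o phi).
Proof.
move=> phic x a; rewrite lte_fin => ax.
by exists [set y | a < phi y] => //; exact: (cvgr_gt _ (phic x)).
Qed.

Lemma lower_semicontinuousD phi psi :
  lower_semicontinuous (EFin \o phi) -> lower_semicontinuous (EFin \o psi) ->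
  lower_semicontinuous (EFin \o (phi \+ psi)).
Proof.
move=> phil psil x a; rewrite lte_fin /= => ax.
pose d := (phi x + psi x - a) / 2; have d0 : 0 < d by rewrite /d; lra.
have [|V xV phiV] := phil x (phi x - d).
  by rewrite lte_fin /= ltrBlDr ltrDl.
have [|W xW psiW] := psil x (psi x - d).
  by rewrite lte_fin /= ltrBlDr ltrDl.
exists (V `&` W); first exact: filterI.
move=> y [/phiV + /psiW]; rewrite !lte_fin /= /d; lra.
Qed.

End LowerSemicontinuity.

Section CompleteSpaces.
Context {R : realType}.

Lemma telescoping_norm_le (X : normedModType R) (z : X ^nat) (u : R ^nat) :
  (forall n, `|z n.+1 - z n| <= u n - u n.+1) ->
  forall m n, (m <= n)%N -> `|z n - z m| <= u m - u n.
Proof.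
move=> dz m n /subnKC <-; elim: (n - m)%N => [|k IH].
  by rewrite addn0 !subrr normr0.
rewrite addnS; apply: le_trans (ler_distD (z (m + k)%N) _ _) _.
have := dz (m + k)%N; lra.
Qed.

Lemma telescoping_cvg (X : completeNormedModType R) (z : X ^nat) (u : R ^nat) :
  (forall n, 0 <= u n) -> (forall n, `|z n.+1 - z n| <= u n - u n.+1) ->
  exists2 l, z @ \oo --> l & forall n, `|l - z n| <= u n.
Proof.
move=> u0 dz; have dz_le := telescoping_norm_le dz.
have u_decr : nonincreasing_seq u.
  apply/nonincreasing_seqP => n.
  by rewrite -subr_ge0; apply: le_trans (dz n); exact: normr_ge0.
have cvgu : cvgn u.
  by apply: nonincreasing_is_cvgn => //; exists 0 => _ [n _ <-].
have /cauchy_cvgP/cvg_ex[l zl] : cauchy (z @ \oo).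
  apply: cauchy_exP => e e0.
  have /cvgr_distC_lt/(_ _ e0)[N _ uN] := cvgu.
  exists (z N); exists N => // n /= Nn; rewrite -ball_normE /= distrC.
  apply: le_lt_trans (dz_le _ _ Nn) _.
  have := uN N (leqnn N); have := nonincreasing_cvgn_ge u_decr cvgu n => /=.
  move=> un /(le_lt_trans (ler_norm _)); lra.
exists l => // m; have zlm : `|z n - z m| @[n --> \oo] --> `|l - z m|.
  by apply: cvg_norm; apply: cvgB => //; exact: cvg_cst.
apply: cvgr_to_le zlm _; near=> n.
have mn : (m <= n)%N by near: n; exact: nbhs_infty_ge.
by apply: le_trans (dz_le _ _ mn) _; rewrite gerBl.
Unshelve. all: by end_near. Qed.

(* Residual-halving iteration, as in the open mapping theorem: starting from
   [u], correct [z] by an approximate preimage of the residual [y - A z]. *)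
Lemma almost_open_linear_regular (X : completeNormedModType R)
    (Y : normedModType R) (A : {linear X -> Y}) (K : R) :
  continuous A -> 0 <= K ->
  (forall v, exists2 w, `|w| <= K * `|v| & `|A w - v| <= `|v| / 2) ->
  forall u y, exists2 w, A w = y & `|u - w| <= K * 2 * `|A u - y|.
Proof.
move=> Ac K0 A_almost_open u y.
have /choice[F F_correct] :
    forall v, exists w, `|w| <= K * `|v| /\ `|A w - v| <= `|v| / 2.
  by move=> v; have [w] := A_almost_open v; exists w.
pose z n := iter n (fun p => p + F (y - A p)) u; pose res n := `|y - A (z n)|.
have res_half n : res n.+1 <= res n / 2.
  rewrite /res /= linearD opprD addrA distrC; exact: (F_correct _).2.
have z_step n : `|z n.+1 - z n| <= K * 2 * res n - K * 2 * res n.+1.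
  rewrite /= [z n + _]addrC addrK.
  have := ler_wpM2l K0 (res_half n); have := (F_correct (y - A (z n))).1.
  rewrite -/(res n); lra.
have K2res n : 0 <= K * 2 * res n by rewrite mulr_ge0 ?normr_ge0 // mulr_ge0.
have [w zw wz] := telescoping_cvg K2res z_step.
exists w; last by have := wz 0%N; rewrite /res distrC [`|y - _|]distrC.
have res_geom n : res n <= res 0%N * 2^-1 ^+ n.
  elim: n => [|n IH]; first by rewrite expr0 mulr1.
  by rewrite exprSr mulrA; apply: le_trans (res_half n) _; rewrite ler_wpM2r.
have Azy : A (z n) @[n --> \oo] --> y.
  apply/cvgrPdist_le => e e0.
  have : res 0%N * 2^-1 ^+ n @[n --> \oo] --> (0 : R).
    by apply: cvg_geometric; rewrite ger0_norm ?invr_ge0 // invf_lt1 // ltr1n.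
  move=> /cvgr0_norm_le/(_ _ e0); apply: filterS => n.
  by apply: le_trans; apply: le_trans (res_geom n) (ler_norm _).
have AzAw : A (z n) @[n --> \oo] --> A w.
  by apply: continuous_cvg => //; exact: Ac.
exact: cvg_unique AzAw Azy.
Qed.

End CompleteSpaces.

Section EkelandVariationalPrinciple.
Context {R : realType} {X : completeNormedModType R}.
Variables (S : set X) (phi : X -> R) (eps : R).
Hypotheses (S_closed : closed S) (phi_lsc : lower_semicontinuous (EFin \o phi)).
Hypotheses (phi_ge0 : forall x, 0 <= phi x) (eps_gt0 : 0 < eps).

Let improvements p := [set q | S q /\ phi q + eps * `|q - p| <= phi p].

Let improvements_refl p : S p -> improvements p p.
Proof. by move=> Sp; split=> //; rewrite subrr normr0 mulr0 addr0. Qed.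

Let improvements_trans p q r :
  improvements p q -> improvements q r -> improvements p r.
Proof.
move=> [_ pq] [Sr qr]; split=> //.
have := ler_wpM2l (ltW eps_gt0) (ler_distD q r p); lra.
Qed.

Let improvements_closed p : closed (improvements p).
Proof.
apply: closedI => //; pose psi q := eps * `|q - p|.
suff : lower_semicontinuous (EFin \o (phi \+ psi)).
  by move=> /(@sublevel_closed _ _ _ (phi p)).
apply: lower_semicontinuousD => //; apply: continuous_lower_semicontinuous.
move=> q; apply: cvgM; first exact: cvg_cst.
by apply: cvg_norm; apply: cvgB; [exact: cvg_id | exact: cvg_cst].
Qed.

(* Halving the distance to the infimum, rather than bringing it below [1/n],
   keeps the choice a relation between points. *)
Let improvement_halving_gap p : S p ->
  exists2 q, improvements p q &
    forall w, improvements p w -> 2 * phi q <= phi p + phi w.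
Proof.
move=> Sp; pose E := phi @` improvements p.
have infE : has_inf E.
  split; last by exists 0 => _ [w _ <-].
  by exists (phi p), p => //; exact: improvements_refl.
have E_ge w : improvements p w -> inf E <= phi w.
  by move=> pw; apply: ge_inf infE.2 _ _; exists w.
have [lt_inf|] := ltP (inf E) (phi p); last first.
  move=> le_inf; exists p => [|w /E_ge]; [exact: improvements_refl | lra].
have gap0 : 0 < (phi p - inf E) / 2 by lra.
have [_ [q pq <-] q_lt] := inf_adherent gap0 infE.
by exists q => // w /E_ge; lra.
Qed.

Let halving_sequence z0 : S z0 ->
  exists2 x : X ^nat, x 0%N = z0 & forall n, improvements (x n) (x n.+1) /\
    forall w, improvements (x n) w -> 2 * phi (x n.+1) <= phi (x n) + phi w.
Proof.
move=> Sz0; have [|z [z_0 z_next]] := @dependent_choice {p | S p}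
  (fun p q => improvements (sval p) (sval q) /\ forall w,
     improvements (sval p) w -> 2 * phi (sval q) <= phi (sval p) + phi w)
  _ (exist _ z0 Sz0).
  move=> [p Sp]; have [q pq q_half] := cid2 (improvement_halving_gap Sp).
  by exists (exist _ q pq.1).
by exists (fun n => sval (z n)); rewrite ?z_0.
Qed.

Let improvements_limit (x : X ^nat) : S (x 0%N) ->
  (forall n, improvements (x n) (x n.+1)) ->
  exists l, forall n, improvements (x n) l.
Proof.
move=> Sx0 x_next.
have Sx n : S (x n) by case: n => // n; exact: (x_next n).1.
have x_le m n : (m <= n)%N -> improvements (x m) (x n).
  move=> /subnKC <-; elim: (n - m)%N => [|k IH].
    by rewrite addn0; exact: improvements_refl.
  by rewrite addnS; exact: improvements_trans IH (x_next _).
have x_step n : `|x n.+1 - x n| <= phi (x n) / eps - phi (x n.+1) / eps.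
  by rewrite -mulrBl ler_pdivlMr // mulrC lerBrDl; exact: (x_next n).2.
have [l xl _] :=
  telescoping_cvg (fun n => divr_ge0 (phi_ge0 _) (ltW eps_gt0)) x_step.
exists l => n; apply: (closed_cvg _ (@improvements_closed (x n)) _ l xl).
by exists n => // m; exact: x_le.
Qed.

Lemma ekeland_variational_principle (z0 : X) : S z0 ->
  exists z, [/\ S z, phi z + eps * `|z - z0| <= phi z0 &
    forall w, S w -> w != z -> phi z < phi w + eps * `|w - z|].
Proof.
move=> Sz0; have [x x0 x_next] := halving_sequence Sz0.
have [|n|l l_le] := @improvements_limit x; first by rewrite x0.
  exact: (x_next n).1.
exists l; split; [exact: (l_le 0%N).1 | by have [_] := l_le 0%N; rewrite x0 |].
move=> w Sw wl; rewrite ltNge; apply/negP => lw.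
have phi_le p q : improvements p q -> phi q <= phi p.
  by move=> [_]; apply: le_trans; rewrite lerDl mulr_ge0 // ltW.
have phi_cvg : cvgn (phi \o x).
  apply: nonincreasing_is_cvgn; last by exists 0 => _ [n _ <-] /=.
  by apply/nonincreasing_seqP => n; exact: phi_le (x_next n).1.
have half_lim : 2 * limn (phi \o x) <= limn (phi \o x) + phi w.
  apply: (@ler_cvg_to _ \oo _ _
    (fun n => 2 * phi (x n.+1)) (fun n => phi (x n) + phi w)).
  - by apply: cvgM; [exact: cvg_cst | rewrite (cvg_shiftS (phi \o x))].
  - by apply: cvgD => //; exact: cvg_cst.
  - apply: nearW => n; apply: (x_next n).2.
    by apply: improvements_trans (l_le n) _.
have l_lim : phi l <= limn (phi \o x).
  by apply: limr_ge => //; apply: nearW => n; exact: phi_le (l_le n).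
have : 0 < eps * `|w - l| by rewrite mulr_gt0 // normr_gt0 subr_eq0.
lra.
Qed.

End EkelandVariationalPrinciple.

Section NearRays.
Context {R : realType} {X : normedModType R}.
Implicit Types (x h s : X) (t : R).

Lemma dist_ray x h t : 0 < t -> `|x + t *: h - x| = t * `|h|.
Proof. by move=> t0; rewrite addrAC subrr add0r normrZ gtr0_norm. Qed.

Lemma dist_scale h s t : 0 < t -> t * `|h - t^-1 *: s| = `|t *: h - s|.
Proof.
move=> t0; rewrite -{1}(gtr0_norm t0) -normrZ scalerBr.
by rewrite scalerKV // gt_eqF.
Qed.

Lemma near_at_right_scaled_ball x (P : set X) (C : R) :
  (\forall x' \near x, P x') ->
  \forall t \near 0^'+, forall x', `|x' - x| <= t * C -> P x'.
Proof.
move=> /nbhs_normP[r /= r0 rP]; have C1 : 0 < `|C| + 1 by rewrite ltr_wpDl.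
near=> t => x' x't; apply: rP; rewrite /ball_ /= distrC.
apply: le_lt_trans x't _; have t0 : 0 < t by near: t; exact: nbhs_right_gt.
have : t < r / (`|C| + 1) by near: t; apply: nbhs_right_lt; exact: divr_gt0.
rewrite ltr_pdivlMr //; apply: le_lt_trans; rewrite ler_pM2l //.
by have := ler_norm C; lra.
Unshelve. all: by end_near. Qed.

Lemma near_at_right_ray x h (P : set X) :
  (\forall x' \near x, P x') -> \forall t \near 0^'+, P (x + t *: h).
Proof.
move=> P_near; near=> t; have t0 : 0 < t by near: t; exact: nbhs_right_gt.
suff : forall x', `|x' - x| <= t * `|h| -> P x' by apply; rewrite dist_ray.
by near: t; exact: near_at_right_scaled_ball.
Unshelve. all: by end_near. Qed.

Lemma near_at_right_pair_lt (v : X) (a e : R) : 0 < a -> 0 < e ->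
  \forall t \near 0^'+ & k \near v, 0 < t < a /\ `|v - k| < e.
Proof.
move=> a0 e0.
exists ([set t | 0 < t < a], [set k | `|v - k| < e]); last by case.
split; last exact: cvgr_dist_lt.
near=> t; apply/andP; split; near: t.
  exact: nbhs_right_gt.
exact: nbhs_right_lt.
Unshelve. all: by end_near. Qed.

Lemma near_dist_le_center (x0 : X) (P : set X) :
  (\forall z \near x0, P z) ->
  \forall x \near x0, forall z, `|x - z| <= `|x - x0| -> P z.
Proof.
move=> /nbhs_normP[r /= r0 rP]; apply/nbhs_normP.
exists (r / 2) => [|x /=]; first exact: divr_gt0.
rewrite /ball_ /= => x0x z xz; apply: rP; rewrite /ball_ /=.
by have := ler_distD x x0 z; move: xz; rewrite (distrC x x0); lra.
Qed.

End NearRays.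

Section Differentiation.
Context {R : realType}.

Lemma differentiable_norm_le (X Y : normedModType R) (g : X -> Y) (x : X)
    (eps : R) :
  differentiable g x -> 0 < eps ->
  \forall x' \near x, `|g x' - g x - 'd g x (x' - x)| <= eps * `|x' - x|.
Proof.
move=> dg e0; have := diff_locally dg; set o := 'o _ => gE.
have /nbhs_normP[r r0 o_le] : \forall h \near (0 : X), `|o h| <= eps * `|h|.
  exact: littleoP.
apply/nbhs_normP; exists r => // x'; rewrite /ball_ /= distrC => x'r.
have := o_le (x' - x); rewrite /ball_ /= sub0r normrN => /(_ x'r) o_x'.
move: (congr1 (fun k => k (x' - x)) gE); rewrite /= subrK => ->.
by rewrite !fctE /= -[X in `|X|]addrA -opprD [X in `|X|]addrC addKr.
Qed.

Lemma differentiable_ray_le (X Y : normedModType R) (g : X -> Y) (z h : X)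
    (eps : R) :
  differentiable g z -> 0 < eps ->
  \forall t \near 0^'+, `|g (z + t *: h) - g z - t *: 'd g z h| <= eps * t.
Proof.
move=> dg eps0; have h1 : 0 < `|h| + 1 by rewrite ltr_wpDl.
near=> t; have t0 : 0 < t by near: t; exact: nbhs_right_gt.
have : forall x, `|x - z| <= t * `|h| ->
    `|g x - g z - 'd g z (x - z)| <= eps / (`|h| + 1) * `|x - z|.
  near: t; apply: near_at_right_scaled_ball.
  by apply: differentiable_norm_le => //; exact: divr_gt0.
move=> /(_ (z + t *: h)); rewrite dist_ray // [z + _ - z]addrAC subrr add0r.
rewrite ['d g z (_ *: _)]linearZ /= => /(_ (lexx _)) /le_trans; apply.
rewrite mulrCA [leRHS]mulrC ler_pM2l // mulrAC ler_pdivrMr //.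
by rewrite ler_pM2l // lerDl.
Unshelve. all: by end_near. Qed.

(* The set of [s] at which the bound holds on [[a, s]] contains its supremum,
   and the local bound there lets one go beyond it unless it is [b]. *)
Lemma mean_value_inequality (Y : normedModType R) (phi : R -> Y) (a b c : R) :
  a <= b ->
  (forall s : R, a <= s <= b ->
    \forall s' \near s, `|phi s' - phi s| <= c * `|s' - s|) ->
  `|phi b - phi a| <= c * (b - a).
Proof.
move=> ab phi_lip.
pose E := [set s : R | a <= s <= b /\ `|phi s - phi a| <= c * (s - a)].
have Ea : E a by split; rewrite ?lexx //= !subrr normr0 mulr0.
have supE : has_sup E by split; [exists a | exists b => s [/andP[]]].
pose m := sup E.
have am : a <= m by apply: ub_le_sup supE.2 _ _.
have mb : m <= b by apply: ge_sup; [exists a | move=> s [/andP[]]].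
have [|r /= r0 m_lip] := (nbhs_normP _ _).1 (phi_lip m _); first by rewrite am.
have Em : `|phi m - phi a| <= c * (m - a).
  have [s sE sm] := sup_adherent r0 supE.
  have le_sm : s <= m by apply: ub_le_sup supE.2 _ sE.
  have /m_lip : `|m - s| < r.
    by rewrite ger0_norm ?subr_ge0 //; rewrite -/m in sm; lra.
  rewrite (distrC s) ger0_norm ?subr_ge0 // => phi_sm.
  apply: le_trans (ler_distD (phi s) _ _) _; rewrite distrC.
  have := sE.2; lra.
have [<-//|m_neq_b] := eqVneq m b.
have lt_mb : m < b by rewrite lt_neqAle m_neq_b.
near m^'+ => s.
have ms : m < s by near: s; exact: nbhs_right_gt.
have sb : s < b by near: s; exact: nbhs_right_lt.
have sr : s - m < r by near: s; exact: nbhs_right_ltDr.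
suff : E s by move=> /(ub_le_sup supE.2); rewrite leNgt ms.
split; first by rewrite (le_trans am (ltW ms)) ltW.
apply: le_trans (ler_distD (phi m) _ _) _.
have /m_lip : `|m - s| < r by rewrite distrC gtr0_norm ?subr_gt0.
rewrite gtr0_norm ?subr_gt0 //; lra.
Unshelve. all: by end_near. Qed.

Lemma segment_mean_value_inequality (X Y : normedModType R) (g : X -> Y)
    (x z : X) (v : Y) (c : R) :
  (forall s : R, 0 <= s <= 1 -> differentiable g (z + s *: (x - z))) ->
  (forall s : R, 0 <= s <= 1 -> `|'d g (z + s *: (x - z)) (x - z) - v| <= c) ->
  `|g x - g z - v| <= c.
Proof.
move=> dg dg_le; apply/ler_addgt0Pr => e e0; set n := `|x - z|.
pose seg s := z + s *: (x - z); pose phi s := g (seg s) - s *: v.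
have segB s s' : seg s' - seg s = (s' - s) *: (x - z).
  by rewrite /seg opprD addrACA subrr add0r scalerBl.
have seg_cvg s : seg s' @[s' --> s] --> seg s.
  by apply: cvgD; [exact: cvg_cst | apply: cvgZr_tmp; exact: cvg_id].
have n1 : 0 < n + 1 by rewrite ltr_wpDl ?normr_ge0.
have en : e / (n + 1) * n <= e.
  by rewrite mulrAC ler_pdivrMr // ler_pM2l // lerDl.
have -> : g x - g z - v = phi 1 - phi 0.
  by rewrite /phi /seg !scale1r !scale0r addr0 subr0 [z + _]addrC subrK addrAC.
suff phi_lip (s : R) : 0 <= s <= 1 ->
    \forall s' \near s, `|phi s' - phi s| <= (c + e) * `|s' - s|.
  by have := mean_value_inequality ler01 phi_lip; rewrite subr0 mulr1.
move=> s01; have : \forall s' \near s,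
    `|g (seg s') - g (seg s) - 'd g (seg s) (seg s' - seg s)| <=
      e / (n + 1) * `|seg s' - seg s|.
  exact: seg_cvg (differentiable_norm_le (dg _ s01) (divr_gt0 e0 n1)).
apply: filterS => s'.
rewrite segB normrZ ['d g _ (_ *: _)]linearZ /= -/n => g_s'.
have -> : phi s' - phi s =
    g (seg s') - g (seg s) - (s' - s) *: 'd g (seg s) (x - z) +
    (s' - s) *: ('d g (seg s) (x - z) - v).
  rewrite scalerBr addrA subrK scalerBl /phi !opprB [s *: v - _]addrC.
  by rewrite addrACA [- _ + _]addrC.
apply: le_trans (ler_normD _ _) _; rewrite normrZ.
have := ler_wpM2l (normr_ge0 (s' - s)) en.
have := ler_wpM2l (normr_ge0 (s' - s)) (dg_le s s01).
move: g_s'; rewrite /seg; lra.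
Qed.

Lemma ball_segment (X : normedModType R) (p x z : X) (r s : R) :
  ball p r x -> ball p r z -> 0 <= s <= 1 -> ball p r (z + s *: (x - z)).
Proof.
rewrite -ball_normE /= => px pz /andP[s0 s1].
have -> : p - (z + s *: (x - z)) = s *: (p - x) + (1 - s) *: (p - z).
  have -> : x - z = p - z - (p - x) by rewrite opprB [RHS]addrC addrA subrK.
  by rewrite opprD addrA scalerBr opprB scalerBl scale1r addrCA.
apply: le_lt_trans (ler_normD _ _) _.
rewrite !normrZ (ger0_norm s0) ger0_norm ?subr_ge0 //.
have [->|sn0] := eqVneq s 0; first by rewrite subr0 mul0r mul1r add0r.
have s_gt0 : 0 < s by rewrite lt_neqAle eq_sym sn0.
have : s * `|p - x| < s * r by rewrite ltr_pM2l.
have : (1 - s) * `|p - z| <= (1 - s) * r by rewrite ler_wpM2l ?subr_ge0 // ltW.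
lra.
Qed.

Lemma C1_continuous (X Y : normedModType R) (g : X -> Y) : C1 g -> continuous g.
Proof. by move=> [dg _] x; exact: differentiable_continuous. Qed.

Lemma C1_strictly_differentiable (X Y : normedModType R) (g : X -> Y) (xbar : X)
    (eps : R) : C1 g -> 0 < eps ->
  \forall x \near xbar & z \near xbar,
    `|g x - g z - 'd g z (x - z)| <= eps * `|x - z|.
Proof.
move=> [dg dg_cont] e0; have e2 : 0 < eps / 2 by lra.
have /nbhs_ballP[r /= r0 dg_near] := dg_cont xbar _ e2.
exists (ball xbar r, ball xbar r) => [|[x z] /= [xr zr]].
  by split; exact: nbhsx_ballx.
apply: segment_mean_value_inequality => // s /(ball_segment xr zr)/dg_near dg_s.
apply: le_trans (ler_distD ('d g xbar (x - z)) _ _) _.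
have := dg_s (x - z); have := dg_near _ zr (x - z).
rewrite (distrC ('d g xbar _)); lra.
Qed.

End Differentiation.

Section DistanceAndExcess.
Context {R : realType} {X : normedModType R}.
Implicit Types (C D : set X) (x y : X).

Lemma edist_le_norm x y D : D y -> (edist x D <= (`|x - y|)%:E)%E.
Proof. by move=> Dy; apply: ereal_inf_lbound; exists y. Qed.

Lemma edist_lt x D (r : R) :
  (edist x D < r%:E)%E -> exists2 y, D y & `|x - y| < r.
Proof. by move=> /ereal_inf_lt[_ [y Dy <-]]; rewrite lte_fin; exists y. Qed.

Lemma edist_ge0 x D : (0 <= edist x D)%E.
Proof. by apply: le_ereal_inf_tmp => _ [y _ <-]; rewrite lee_fin. Qed.

Lemma excess_ge0 C D : (0 <= excess C D)%E.
Proof.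
rewrite /excess; case: ifPn => [_|/set0P[x Cx]]; first by case: ifP.
by apply: le_trans (edist_ge0 x D) _; apply: ereal_sup_ubound; exists x.
Qed.

Lemma edist_le_excess C D x : C x -> (edist x D <= excess C D)%E.
Proof.
move=> Cx; rewrite /excess; case: ifPn => [/eqP C0|_].
  by rewrite C0 in Cx.
by apply: ereal_sup_ubound; exists x.
Qed.

Lemma excess_le C D (c : \bar R) :
  C !=set0 -> (forall x, C x -> (edist x D <= c)%E) -> (excess C D <= c)%E.
Proof.
move=> /set0P/negbTE C0 dist_le; rewrite /excess C0.
by apply: ge_ereal_sup => _ [x Cx <-]; exact: dist_le.
Qed.

End DistanceAndExcess.

Lemma lim_at_right_ereal_inf {R : realType} (F : R -> \bar R) :
  (forall s t, 0 < s -> s <= t -> (F s <= F t)%E) ->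
  lim (F @ 0^'+) = ereal_inf [set F t | t in [set t | 0 < t]].
Proof.
move=> F_homo; apply: (cvg_lim (@ereal_hausdorff R)).
have -> : [set t | 0 < t] = [set` Interval (BRight (0 : R)) +oo%O].
  by apply/seteqP; split => t /=; rewrite in_itv /= andbT.
apply: nondecreasing_at_right_cvge => // s t.
by rewrite !in_itv /= !andbT => s0 _; exact: F_homo.
Qed.

Section UpperLimit.
Context {R : realType} {X : normedModType R}.
Variables (F : X -> \bar R) (D : set X) (xbar : X).
Hypothesis F_ge0 : forall x, (0 <= F x)%E.

Lemma sup0_ge0 (A : set X) : (0 <= sup0 (F @` A))%E.
Proof.
rewrite /sup0; case: ifPn => // /set0P[_ [x Ax _]].
by apply: le_trans (F_ge0 x) _; apply: ereal_sup_ubound; exists x.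
Qed.

Lemma sup0_ubound (A : set X) x : A x -> (F x <= sup0 (F @` A))%E.
Proof.
move=> Ax; rewrite /sup0; case: ifPn => [/eqP A0|_].
  have : (F @` A) (F x) by exists x.
  by rewrite A0.
by apply: ereal_sup_ubound; exists x.
Qed.

Lemma sup0_le (A : set X) (c : \bar R) :
  (0 <= c)%E -> (forall x, A x -> (F x <= c)%E) -> (sup0 (F @` A) <= c)%E.
Proof.
move=> c0 Fc; rewrite /sup0; case: ifPn => // _.
by apply: ge_ereal_sup => _ [x Ax <-]; exact: Fc.
Qed.

Lemma limsup_inE : limsup_in F D xbar = ereal_inf
  [set sup0 [set F x | x in D `&` ball xbar d] | d in [set d | 0 < d]].
Proof.
apply: lim_at_right_ereal_inf => s t s0 st; apply: sup0_le => [|x [Dx xs]].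
  exact: sup0_ge0.
by apply: sup0_ubound; split=> //; exact: le_ball st _ xs.
Qed.

Lemma limsup_in_ge0 : (0 <= limsup_in F D xbar)%E.
Proof.
by rewrite limsup_inE; apply: le_ereal_inf_tmp => _ [d _ <-]; exact: sup0_ge0.
Qed.

Lemma limsup_in_le (c : \bar R) : (0 <= c)%E ->
  (\forall x \near xbar, D x -> (F x <= c)%E) -> (limsup_in F D xbar <= c)%E.
Proof.
move=> c0 /nbhs_ballP[d d0 Fc]; rewrite limsup_inE; apply: ge_ereal_inf.
exists (sup0 [set F x | x in D `&` ball xbar d]); first by exists d.
by apply: sup0_le => // x [Dx xd]; exact: Fc.
Qed.

Lemma limsup_in_lt (c : \bar R) : (limsup_in F D xbar < c)%E ->
  \forall x \near xbar, D x -> (F x < c)%E.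
Proof.
rewrite limsup_inE => /ereal_inf_lt[_ [d d0 <-]] sup_lt.
apply/nbhs_ballP; exists d => // x xd Dx; apply: le_lt_trans sup_lt.
exact: sup0_ubound.
Qed.

End UpperLimit.

Section ConvexFunctions.
Context {R : realType} {Y : normedModType R}.
Variable f : Y -> \bar R.
Hypothesis f_convex : econvex f.
Implicit Types (y v : Y) (s t c : R).

Lemma econvex_increment y v s t : f y \is a fin_num -> 0 < s -> s <= t ->
  (f (y + s *: v)%R - f y <= (s / t)%:E * (f (y + t *: v)%R - f y))%E.
Proof.
move=> fy s0; rewrite le_eqVlt => /predU1P[<-|st].
  by rewrite divff ?gt_eqF // mul1e.
have t0 : 0 < t by exact: lt_trans st.
have st01 : 0 < s / t < 1 by rewrite divr_gt0 //= ltr_pdivrMr // mul1r.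
have := f_convex (y + t *: v) y st01.
have -> : s / t *: (y + t *: v) + (1 - s / t) *: y = y + s *: v.
  rewrite scalerDr scalerA divfK ?gt_eqF // addrAC -scalerDl.
  by rewrite [s / t + _]addrC subrK scale1r.
move: fy; case: (f y) => // r _; have [st0 _] := andP st01.
rewrite leeBlDr //; case: (f (y + t *: v)) => [a| |] /le_trans; apply.
- by rewrite -!EFinM -!EFinD lee_fin; lra.
- by rewrite gt0_muley ?lte_fin // addye // leey.
- by rewrite gt0_muleNy ?lte_fin // addNye leNye.
Qed.

Lemma dplusE y v : f y \is a fin_num -> dplus f y v = ereal_inf
  [set ((f (y + t *: v)%R - f y) * (t^-1)%:E)%E | t in [set t | 0 < t]].
Proof.
move=> fy; apply: lim_at_right_ereal_inf => s t s0 st.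
rewrite lee_pdivrMr // -muleA -EFinM muleC [(_^-1 * _)%R]mulrC.
exact: econvex_increment.
Qed.

Lemma dplus_le_quotient y v t : f y \is a fin_num -> 0 < t ->
  (dplus f y v <= (f (y + t *: v)%R - f y) * (t^-1)%:E)%E.
Proof.
by move=> fy t0; rewrite dplusE //; apply: ereal_inf_lbound; exists t.
Qed.

Lemma dplus_lt_near y v c : f y \is a fin_num -> (dplus f y v < c%:E)%E ->
  \forall t \near 0^'+, (f (y + t *: v)%R - f y <= (c * t)%:E)%E.
Proof.
move=> fy; rewrite dplusE // => /ereal_inf_lt[_ [t0 /= t0_gt0 <-]] /ltW.
rewrite lee_pdivrMr // => f_t0; near=> t.
have t_gt0 : 0 < t by near: t; exact: nbhs_right_gt.
have t_le : t <= t0 by near: t; exact: nbhs_right_le.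
apply: le_trans (econvex_increment v fy t_gt0 t_le) _.
have tt0 : (0 <= (t / t0)%:E :> \bar R)%E by rewrite lee_fin divr_ge0 // ltW.
apply: le_trans (lee_wpmul2l tt0 f_t0) _.
by rewrite -!EFinM mulrCA divfK ?gt_eqF.
Unshelve. all: by end_near. Qed.

End ConvexFunctions.

Section BouligandCone.
Context {R : realType} {Y : normedModType R}.
Implicit Types (C : set Y) (c v : Y).

Lemma bouligand_scale C c v (r : R) :
  0 < r -> bouligand C c v -> bouligand C c (r *: v).
Proof.
move=> r0 [vn [tn [vn_v [tn_0 [tn_gt0 C_n]]]]].
exists (fun n => r *: vn n), (fun n => tn n / r); split; last split; last split.
- exact: cvgZl_tmp.
- by rewrite -(mul0r r^-1); apply: cvgMr_tmp.
- by move=> n; rewrite divr_gt0.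
- by move=> n; rewrite scalerA divfK ?gt_eqF.
Qed.

Lemma bouligandP C c v : bouligand C c v <->
  forall P : R -> Y -> Prop, (\forall t \near 0^'+ & k \near v, P t k) ->
    exists t k, P t k /\ C (c + t *: k).
Proof.
split=> [[vn [tn [vn_v [tn_0 [tn_gt0 C_n]]]]] P P_near|meets].
  have tn_0r : tn @ \oo --> 0^'+.
    move=> A /tn_0 tnA.
    apply: (@filterS _ \oo _ (fun n => 0 < tn n -> A (tn n))) tnA => n.
    by apply.
  have [n Pn] := @filter_ex _ \oo _ _ (cvg_pair tn_0r vn_v P_near).
  by exists (tn n), (vn n).
have /choice[p p_n] : forall n, exists p : R * Y,
    [/\ 0 < p.1 < n.+1%:R^-1, `|v - p.2| < n.+1%:R^-1 & C (c + p.1 *: p.2)].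
  move=> n; have n0 : 0 < n.+1%:R^-1 :> R by [].
  have [t [k [[tn vk] Ctk]]] := meets _ (near_at_right_pair_lt v n0 n0).
  by exists (t, k).
have harmonic_cvg0 := @cvg_harmonic R.
exists (fun n => (p n).2), (fun n => (p n).1); split; last split; last split.
- apply/cvgrPdist_lt => e e0.
  have /cvgr0_norm_lt/(_ _ e0) := harmonic_cvg0; apply: filterS => n /= n_e.
  have [_ /lt_trans vk _] := p_n n.
  by apply: vk; exact: le_lt_trans (ler_norm _) n_e.
- apply: (squeeze_cvgr _ (cvg_cst 0) harmonic_cvg0); apply: nearW => n.
  by have [/andP[/ltW -> /ltW ->]] := p_n n.
- by move=> n; have [/andP[]] := p_n n.
- by move=> n; have [] := p_n n.
Qed.

Lemma bouligand_ray C c v :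
  (\forall t \near 0^'+, C (c + t *: v)) -> bouligand C c v.
Proof.
move=> ray; apply/bouligandP => P [[A B] /= [nA nB] AB_P].
have [t [At Ct]] := filter_ex (filterI nA ray).
exists t, v; split=> //; apply: (AB_P (t, v)).
by split=> //; exact: nbhs_singleton.
Qed.

Lemma bouligand_interior C c v : interior C c -> bouligand C c v.
Proof.
by move=> C_near; apply: bouligand_ray; exact: near_at_right_ray.
Qed.

Lemma bouligand_sublevel (f : Y -> \bar R) (c : R) (y y' : Y) :
  econvex f -> (f y <= c%:E)%E -> (f y' <= c%:E)%E ->
  bouligand (sublevel f c%:E) y (y' - y).
Proof.
move=> f_convex fy fy'; apply: bouligand_ray; near=> t.
have t0 : 0 < t by near: t; exact: nbhs_right_gt.
have t1 : t < 1 by near: t; exact: nbhs_right_lt.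
have t01 : 0 < t < 1 by rewrite t0.
have -> : y + t *: (y' - y) = t *: y' + (1 - t) *: y.
  by rewrite scalerBr scalerBl scale1r addrCA.
rewrite /sublevel /=; apply: le_trans (f_convex y' y t t01) _.
have -> : c%:E = (t%:E * c%:E + (1 - t)%:E * c%:E)%E.
  by rewrite -!EFinM -EFinD -mulrDl [t + _]addrC subrK mul1r.
by apply: leeD; apply: lee_wpmul2l => //; rewrite lee_fin ?subr_ge0 ltW.
Unshelve. all: by end_near. Qed.

End BouligandCone.

Lemma bdry_preimage_sub {T U : topologicalType} (g : T -> U) (C : set U) :
  continuous g -> bdry (g @^-1` C) `<=` g @^-1` bdry C.
Proof.
move=> g_cont x [xC x_notin]; split=> [B /g_cont/xC[x' [Cgx' Bgx']]|gxC].
  by exists (g x').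
exact: x_notin (g_cont x _ gxC).
Qed.

Section AlmostProjection.
Context {R : realType} {X : completeNormedModType R}.
Implicit Types (S : set X) (x z k : X).

Lemma almost_projection_bouligand S x z (eps : R) : 0 <= eps ->
  (forall s, S s -> `|x - z| <= `|x - s| + eps * `|s - z|) ->
  forall k, bouligand S z k -> `|x - z| <= `|x - z - k| + eps * `|k|.
Proof.
move=> eps0 z_min k /bouligandP tangent; apply/ler_addgt0Pr => e e0.
have e1 : 0 < e / (1 + eps) by rewrite divr_gt0 // ltr_pwDl.
have [t [k' [[/andP[t0 t1] kk'] /z_min]]] :=
  tangent _ (near_at_right_pair_lt k ltr01 e1).
rewrite dist_ray // opprD addrA.
have -> : x - z - t *: k' = (1 - t) *: (x - z) + t *: (x - z - k').
  by rewrite scalerBl scale1r [t *: (_ - k')]scalerBr addrA subrK.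
have := ler_normD ((1 - t) *: (x - z)) (t *: (x - z - k')).
rewrite !normrZ gtr0_norm ?subr_gt0 // (gtr0_norm t0) => x_t z_le.
have {x_t z_le} : `|x - z| <= `|x - z - k'| + eps * `|k'|.
  by rewrite -(ler_pM2l t0); lra.
have : (1 + eps) * `|k - k'| <= e.
  by rewrite mulrC -ler_pdivlMr ?ltW // ltr_pwDl.
have := ler_wpM2l eps0 (ler_distD k k' 0); have := ler_distD k (x - z) k'.
rewrite !subr0 (distrC k'); lra.
Qed.

Lemma exists_almost_projection S x z0 (theta : R) :
  closed S -> S z0 -> ~ S x -> 0 < theta < 1 ->
  exists z, [/\ bdry S z, S z, `|x - z| <= `|x - z0| &
    forall k, bouligand S z k -> (1 - theta) * `|x - z| <= `|x - z - k|].
Proof.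
move=> S_closed Sz0 xS /andP[theta0 theta1].
pose eps := theta / 2; have eps0 : 0 < eps by rewrite /eps; lra.
have phi_lsc : lower_semicontinuous (EFin \o (fun u => `|x - u|)).
  apply: continuous_lower_semicontinuous => u.
  by apply: cvg_norm; apply: cvgB; [exact: cvg_cst | exact: cvg_id].
have [z [Sz z_le z_min]] := ekeland_variational_principle S_closed phi_lsc
  (fun u => normr_ge0 (x - u)) eps0 Sz0.
have z_dist k : bouligand S z k -> (1 - theta) * `|x - z| <= `|x - z - k|.
  move=> Sk; have : `|x - z| <= `|x - z - k| + eps * `|k|.
    apply: almost_projection_bouligand Sk => [|s Ss]; first exact: ltW.
    have [->|/(z_min _ Ss)/ltW //] := eqVneq s z.
    by rewrite subrr normr0 mulr0 addr0.
  have := ler_normB (x - z) (x - z - k); rewrite opprB addrCA subrr addr0.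
  move=> /(ler_wpM2l (ltW eps0)) k_le xz_le.
  have eps1 : 0 < 1 + eps by lra.
  have epsK : theta = 2 * eps by rewrite /eps; lra.
  rewrite -(ler_pM2l eps1) epsK.
  have := mulr_ge0 (mulr_ge0 (ltW eps0) (ltW eps0)) (normr_ge0 (x - z)); lra.
exists z; split=> //.
- split=> [|Sz_int]; first exact: subset_closure.
  have := z_dist _ (bouligand_interior (x - z) Sz_int).
  rewrite subrr normr0 pmulr_rle0 ?subr_gt0 // normr_le0 subr_eq0 => /eqP xz.
  by apply: xS; rewrite xz.
- by apply: le_trans z_le; rewrite lerDl mulr_ge0 // ltW.
Qed.

End AlmostProjection.

Definition metric_regular_with {R : realType} {X Y : normedModType R}
    (K : R) (g : X -> Y) (z : X) : Prop :=
  \forall x \near z & y \near g z,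
    exists2 x', g x' = y & `|x - x'| <= K * `|g x - y|.

Lemma metric_regular_near {R : realType} {X Y : normedModType R} (g : X -> Y)
    (xbar : X) :
  continuous g -> metric_regular g xbar ->
  exists2 K, 0 < K & \forall z \near xbar, metric_regular_with K g z.
Proof.
move=> g_cont [K [K0 [U [V [xU [gV g_reg]]]]]].
(* The distance to a fiber need not be attained, hence the larger constant. *)
exists (K + 1); first lra.
have xV : nbhs xbar (g @^-1` V°) by apply: g_cont; exact: nbhs_interior.
apply: filterS (filterI (nbhs_interior xU) xV) => z [zU zV].
exists (U, V) => //= -[x y] /= [Ux Vy].
have [<-|gx_y] := eqVneq (g x) y.
  by exists x; rewrite ?subrr ?normr0 ?mulr0.
have gx_y0 : 0 < `|g x - y| by rewrite normr_gt0 subr_eq0.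
have /edist_lt[x' gx' xx'] :
    (edist x (g @^-1` [set y]) < ((K + 1) * `|g x - y|)%:E)%E.
  by apply: le_lt_trans (g_reg _ _ Ux Vy) _; rewrite lte_fin ltr_pM2r //; lra.
by exists x' => //; exact: ltW.
Qed.

Section RegularMaps.
Context {R : realType} {X Y : normedModType R}.
Variables (g : X -> Y) (z : X) (K : R).
Hypotheses (dg : differentiable g z) (K_gt0 : 0 < K).
Hypothesis g_regular : metric_regular_with K g z.

Lemma metric_regular_lift_ray (h : X) (eps : R) : 0 < eps ->
  \forall t \near 0^'+ & v \near 'd g z h,
    exists2 s, g s = g z + t *: v & `|z + t *: h - s| <= eps * t.
Proof.
move=> eps0; have [[U V] [/= zU gzV] solve] := g_regular.
pose r := eps / (2 * K); have r0 : 0 < r by rewrite divr_gt0 // mulr_gt0.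
pose T := [set t : R | [/\ 0 < t, U (z + t *: h),
  forall y, `|y - g z| <= t * (`|'d g z h| + r) -> V y &
  `|g (z + t *: h) - g z - t *: 'd g z h| <= r * t]].
exists (T, [set v | `|'d g z h - v| < r]).
  split; last exact: cvgr_dist_lt.
  near=> t; split.
  - by near: t; exact: nbhs_right_gt.
  - by near: t; exact: near_at_right_ray.
  - by near: t; exact: near_at_right_scaled_ball.
  - by near: t; exact: differentiable_ray_le.
move=> [t v] /= [[t0 Ut Vt g_t] v_r].
have tv : `|t *: 'd g z h - t *: v| <= t * r.
  by rewrite -scalerBr normrZ gtr0_norm // ler_pM2l // ltW.
have [|s gs s_le] := solve (z + t *: h, g z + t *: v).
  split=> //=; apply: Vt; rewrite dist_ray // ler_pM2l //.
  have := ler_distD ('d g z h) v 0; rewrite !subr0 (distrC v); lra.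
exists s => //; apply: le_trans s_le _ => /=; rewrite opprD addrA.
have := ler_distD (t *: 'd g z h) (g (z + t *: h) - g z) (t *: v).
have -> : eps = K * (r + r) by rewrite /r; field; rewrite gt_eqF.
by rewrite -mulrA ler_pM2l //; lra.
Unshelve. all: by end_near. Qed.

Lemma bouligand_preimage (C : set Y) (h : X) :
  bouligand C (g z) ('d g z h) -> bouligand (g @^-1` C) z h.
Proof.
move=> /bouligandP tangent.
apply/bouligandP => P [[A B] /= [A_near B_near] AB_P].
have /nbhs_normP[r /= r0 rB] := B_near.
have r2 : 0 < r / 2 by lra.
have [[A' B'] /= [A'_near B'_near] lift] := metric_regular_lift_ray h r2.
pose D := [set t | [/\ A t, 0 < t & A' t]].
have D_near : \forall t \near 0^'+, D t.
  near=> t; split; near: t => //; exact: nbhs_right_gt.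
have [|t [v [[[At t0 A't] B'v] Cv]]] := tangent (fun t v => D t /\ B' v).
  by exists (D, B') => //.
have [s gs s_le] := lift (t, v) (conj A't B'v).
exists t, (t^-1 *: (s - z)); split; last first.
  by rewrite scalerKV ?gt_eqF // addrC subrK /preimage /= gs.
apply: (AB_P (t, _)); split=> //=; apply: rB; rewrite /ball_ /=.
rewrite -(ltr_pM2l t0) dist_scale // opprB addrA [_ + z]addrC.
apply: le_lt_trans s_le _; rewrite mulrC ltr_pM2l //=.
by rewrite ltr_pdivrMr // ltr_pMr // ltr1n.
Unshelve. all: by end_near. Qed.

End RegularMaps.

Lemma metric_regular_diff {R : realType} {X : completeNormedModType R}
    {Y : normedModType R} (g : X -> Y) (z : X) (K : R) :
  differentiable g z -> 0 < K -> metric_regular_with K g z ->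
  forall u y, exists2 w, 'd g z w = y & `|u - w| <= K * 2 * `|'d g z u - y|.
Proof.
move=> dg K0 [[U V] [/= zU gzV] solve].
apply: almost_open_linear_regular => [||v].
- exact: diff_continuous.
- exact: ltW.
- have K2 : 0 < (K * 2)^-1 by rewrite invr_gt0 mulr_gt0.
  near (0 : R)^'+ => t; have t0 : 0 < t by near: t; exact: nbhs_right_gt.
  have V_t : V (g z + t *: v) by near: t; exact: near_at_right_ray.
  have g_t : forall x, `|x - z| <= t * (K * `|v|) ->
      `|g x - g z - 'd g z (x - z)| <= (K * 2)^-1 * `|x - z|.
    by near: t; apply: near_at_right_scaled_ball; exact: differentiable_norm_le.
  have [|x gx zx] := solve (z, g z + t *: v).
    by split=> //; exact: nbhs_singleton.
  move: zx; rewrite /= [`|g z - _|]distrC dist_ray // distrC mulrCA => xz.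
  exists (t^-1 *: (x - z)).
    by rewrite normrZ gtr0_norm ?invr_gt0 // ler_pdivrMl.
  rewrite ['d g z (_ *: _)]linearZ /= distrC -(ler_pM2l t0) dist_scale //.
  have := g_t _ xz; rewrite gx [g z + _]addrC addrK => /le_trans; apply.
  by rewrite ler_pdivrMl ?mulr_gt0 // (le_trans xz) //; lra.
Unshelve. all: by end_near. Qed.

Lemma C1_metric_regular_correction {R : realType} {X : completeNormedModType R}
    {Y : normedModType R} (g : X -> Y) (xbar : X) (theta : R) :
  C1 g -> metric_regular g xbar -> 0 < theta ->
  \forall x \near xbar & z \near xbar,
    exists2 h, 'd g z h = g x - g z & `|x - z - h| <= theta * `|x - z|.
Proof.
move=> g_C1 g_regular theta0; have g_cont := C1_continuous g_C1.
have [K K0 g_reg] := metric_regular_near g_cont g_regular.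
have K20 : 0 < K * 2 by rewrite mulr_gt0.
have [[U V] [/= U_near V_near] g_strict] :=
  C1_strictly_differentiable xbar g_C1 (divr_gt0 theta0 K20).
exists (U, V `&` metric_regular_with K g) => [|[x z] /= [Ux [Vz g_regz]]].
  by split=> //; exact: filterI.
have [h dh h_le] :=
  metric_regular_diff (g_C1.1 z) K0 g_regz (x - z) (g x - g z).
exists h => //; apply: le_trans h_le _.
rewrite distrC mulrC -ler_pdivlMr //.
by apply: le_trans (g_strict (x, z) _) _; rewrite //= mulrAC.
Qed.

Section ErrorBounds.
Context {R : realType} {X Y : normedModType R}.
Variables (f : Y -> \bar R) (g : X -> Y).
Implicit Types (x xbar : X) (tau : R).

Definition error_bound_at tau x : Prop :=
  (edist x (g @^-1` sublevel f 0) <= tau%:E * maxe (f (g x)) 0)%E.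

Lemma error_bound_atP tau x : 0 < tau ->
  (forall c, 0 < c -> f (g x) = c%:E ->
     (edist x (g @^-1` sublevel f 0) <= (tau * c)%:E)%E) ->
  error_bound_at tau x.
Proof.
move=> tau0 dist_le; rewrite /error_bound_at; have [xS|] := leP (f (g x)) 0%E.
  by rewrite mule0 (le_trans (edist_le_norm x xS)) // subrr normr0.
case fgx : (f (g x)) => [c| |] // c0; first exact: dist_le.
by rewrite gt0_muley ?leey // lte_fin.
Qed.

Lemma error_bound_withE tau xbar : error_bound_with f g xbar tau <->
  \forall x \near xbar, error_bound_at tau x.
Proof.
split=> [[d [d0 bound]]|/nbhs_ballP[d d0 bound]]; last by exists d.
by apply/nbhs_ballP; exists d.
Qed.

Lemma local_error_bound_modulus xbar :
  local_error_bound f g xbar <-> (eb_modulus f g xbar < +oo)%E.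
Proof.
split=> [[tau [tau0 bound]]|/ereal_inf_lt[_ [tau [tau0 bound] _] _]].
  by apply: le_lt_trans (ltry tau); apply: ereal_inf_lbound; exists tau.
by exists tau.
Qed.

End ErrorBounds.

Section SlopeExcess.
Context {R : realType} {X Y : normedModType R}.
Variables (f : Y -> \bar R) (g : X -> Y).

Definition pullback_tangents (x : X) : set X :=
  'd g x @^-1` bouligand (sublevel f 0) (g x).

Definition slope_excess (x : X) : \bar R :=
  excess [set h | (dplus f (g x) ('d g x h) <= 1)%E] (pullback_tangents x).

Lemma slope_excess_ge0 (x : X) : (0 <= slope_excess x)%E.
Proof. exact: excess_ge0. Qed.

Hypothesis f_convex : econvex f.

Lemma tangent_of_slope_excess_lt (z h : X) (lam c : R) :
  f (g z) = 0%E -> 0 < c ->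
  (slope_excess z < lam%:E)%E -> (f (g z + 'd g z h)%R <= c%:E)%E ->
  exists2 k, pullback_tangents z k & `|h - k| < lam * c.
Proof.
move=> fgz c0 excess_lt f_h; have ci0 : 0 < c^-1 by rewrite invr_gt0.
have slope_h : (dplus f (g z) ('d g z (c^-1 *: h)) <= 1)%E.
  apply: le_trans (dplus_le_quotient f_convex _ _ c0) _; first by rewrite fgz.
  rewrite ['d g z (_ *: _)]linearZ /= scalerKV ?gt_eqF // fgz sube0.
  by rewrite lee_pdivrMr // mul1e.
have [k k_tangent hk] :=
  edist_lt (le_lt_trans (edist_le_excess _ slope_h) excess_lt).
exists (c *: k).
  rewrite /pullback_tangents /= ['d g z (_ *: _)]linearZ /=.
  exact: bouligand_scale.
by rewrite distrC -dist_scale // distrC mulrC ltr_pM2r.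
Qed.

Lemma almost_projection_dist_le (x z h : X) (lam theta c : R) :
  f (g z) = 0%E -> 0 < c -> (f (g x) <= c%:E)%E ->
  (slope_excess z < lam%:E)%E ->
  'd g z h = g x - g z -> `|x - z - h| <= theta * `|x - z| ->
  (forall k, pullback_tangents z k -> (1 - theta) * `|x - z| <= `|x - z - k|) ->
  (1 - 2 * theta) * `|x - z| <= lam * c.
Proof.
move=> fgz c0 fgx excess_z dh xzh z_dist.
have [|k /z_dist xzk hk] := tangent_of_slope_excess_lt fgz c0 excess_z (h := h).
  by rewrite dh addrC subrK.
have := ler_distD h (x - z) k; lra.
Qed.

End SlopeExcess.

Section TangentsOfSublevelSets.
Context {R : realType} {X : completeNormedModType R} {Y : normedModType R}.
Variables (g : X -> Y) (f : Y -> \bar R) (x : X) (K : R).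
Hypotheses (dg : differentiable g x) (K_gt0 : 0 < K).
Hypotheses (g_regular : metric_regular_with K g x) (f_convex : econvex f).

Lemma sublevel_near_tangents (eps : R) : (f (g x) <= 0)%E -> 0 < eps ->
  \forall s \near x, (f (g s) <= 0)%E ->
    exists2 k, pullback_tangents f g x k & `|s - x - k| <= eps * `|s - x|.
Proof.
move=> fgx eps0; have K20 : 0 < K * 2 by rewrite mulr_gt0.
apply: filterS (differentiable_norm_le dg (divr_gt0 eps0 K20)) => s gs fgs.
have [k dk k_le] := metric_regular_diff dg K_gt0 g_regular (s - x) (g s - g x).
exists k.
  by rewrite /pullback_tangents /= dk; exact: (@bouligand_sublevel _ _ f 0).
apply: le_trans k_le _; rewrite distrC mulrC -ler_pdivlMr //.
by apply: le_trans gs _; rewrite mulrAC.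
Qed.

Hypothesis fgx : f (g x) = 0%E.

Lemma error_bound_ray (tau e : R) (h : X) : 0 < tau -> 0 < e ->
  (\forall q \near x, error_bound_at f g tau q) ->
  (dplus f (g x) ('d g x h) <= 1)%E ->
  \forall t \near 0^'+,
    exists2 s, (f (g s) <= 0)%E & `|x + t *: h - s| <= (tau + e) * t.
Proof.
move=> tau0 e0 bound slope_le; pose e' := e / (tau + 2).
have e'0 : 0 < e' by rewrite divr_gt0 // addr_gt0.
have eE : e = e' * (tau + 2) by rewrite /e' divfK // gt_eqF // addr_gt0.
have [[A B] [/= A_near B_near] lift] :=
  metric_regular_lift_ray dg K_gt0 g_regular h e'0.
have slope_lt : (dplus f (g x) ('d g x h) < (1 + e')%:E)%E.
  by apply: le_lt_trans slope_le _; rewrite lte_fin ltrDl.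
have fgx_fin : f (g x) \is a fin_num by rewrite fgx.
near=> t; have t0 : 0 < t by near: t; exact: nbhs_right_gt.
have f_t : (f (g x + t *: 'd g x h)%R <= ((1 + e') * t)%:E)%E.
  by rewrite -[leLHS]sube0 -fgx; near: t; exact: dplus_lt_near.
have bound_t :
    forall q, `|q - x| <= t * (`|h| + e') -> error_bound_at f g tau q.
  by near: t; exact: near_at_right_scaled_ball.
have [|q gq /= q_le] := lift (t, 'd g x h).
  by split; [near: t | exact: nbhs_singleton].
have t1 : 0 < (1 + e') * t by rewrite mulr_gt0 // addr_gt0.
have /edist_lt[s fgs qs] :
    (edist q (g @^-1` sublevel f 0) < ((tau * (1 + e') + e') * t)%:E)%E.
  apply: le_lt_trans (bound_t _ _) _.
    have := ler_distD (x + t *: h) q x; rewrite (distrC q (x + _)).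
    by rewrite dist_ray //; lra.
  have fq : (maxe (f (g q)) 0 <= ((1 + e') * t)%:E)%E.
    by rewrite ge_max gq f_t lee_fin ltW.
  apply: le_lt_trans (lee_wpmul2l _ fq) _; first by rewrite lee_fin ltW.
  by rewrite -EFinM lte_fin mulrA ltr_pM2r // ltrDl.
exists s => //; have := ler_distD q (x + t *: h) s; rewrite eE; lra.
Unshelve. all: by end_near. Qed.

Lemma edist_tangents_le (tau : R) (h : X) : 0 < tau ->
  (\forall q \near x, error_bound_at f g tau q) ->
  (dplus f (g x) ('d g x h) <= 1)%E ->
  (edist h (pullback_tangents f g x) <= tau%:E)%E.
Proof.
move=> tau0 bound slope_le; apply/lee_addgt0Pr => eta eta0.
pose C := `|h| + tau + 1.
have C0 : 0 < C by rewrite /C; have := normr_ge0 h; lra.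
pose e := Num.min 1 (eta / (1 + C)).
have e0 : 0 < e by rewrite lt_min ltr01 divr_gt0 // addr_gt0.
have e_le1 : e <= 1 by rewrite ge_min lexx.
have eC : e * (1 + C) <= eta.
  by rewrite -ler_pdivlMr ?ge_min ?lexx ?orbT // addr_gt0.
have fgx_le : (f (g x) <= 0)%E by rewrite fgx.
near (0 : R)^'+ => t; have t0 : 0 < t by near: t; exact: nbhs_right_gt.
have [s fgs s_le] :
    exists2 s, (f (g s) <= 0)%E & `|x + t *: h - s| <= (tau + e) * t.
  by near: t; exact: error_bound_ray.
have tangent_t : forall s, `|s - x| <= t * C -> (f (g s) <= 0)%E ->
    exists2 k, pullback_tangents f g x k & `|s - x - k| <= e * `|s - x|.
  by near: t; apply: near_at_right_scaled_ball; exact: sublevel_near_tangents.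
have sx : `|s - x| <= t * C.
  have := ler_distD (x + t *: h) s x; rewrite (distrC s (x + _)).
  have := ler_wpM2r (ltW t0) e_le1; rewrite dist_ray // /C; lra.
have [k k_tangent sk] := tangent_t _ sx fgs.
have tangent_k : pullback_tangents f g x (t^-1 *: k).
  rewrite /pullback_tangents /= ['d g x (_ *: _)]linearZ /=.
  by apply: bouligand_scale k_tangent; rewrite invr_gt0.
apply: le_trans (edist_le_norm h tangent_k) _; rewrite -EFinD lee_fin.
rewrite -(ler_pM2l t0) dist_scale //.
have -> : t *: h - k = (x + t *: h - s) + (s - x - k).
  by rewrite !addrA subrK [x + _]addrC addrK.
apply: le_trans (ler_normD _ _) _.
have := ler_wpM2l (ltW e0) sx; have := ler_wpM2l (ltW t0) eC; lra.
Unshelve. all: by end_near. Qed.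

Lemma slope_excess_le_of_error_bound (tau : R) : 0 < tau ->
  (\forall q \near x, error_bound_at f g tau q) ->
  (slope_excess f g x <= tau%:E)%E.
Proof.
move=> tau0 bound; apply: excess_le => [|h]; last exact: edist_tangents_le.
exists 0; rewrite /= ['d g x 0]linear0.
apply: le_trans (dplus_le_quotient f_convex _ _ ltr01) _; first by rewrite fgx.
by rewrite scaler0 addr0 fgx sube0 mul0e lee01.
Qed.

End TangentsOfSublevelSets.

Section ErrorBoundModulus.
Context {R : realType} {X : completeNormedModType R} {Y : normedModType R}.
Variables (g : X -> Y) (f : Y -> \bar R) (xbar : X).
Hypotheses (g_C1 : C1 g) (f_lsc : lower_semicontinuous f).
Hypothesis f_convex : econvex f.
Hypothesis bdry_f0 : bdry (sublevel f 0) `<=` [set y | f y = 0%E].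
Hypotheses (fxbar : (f (g xbar) <= 0)%E) (g_regular : metric_regular g xbar).

Let S := g @^-1` sublevel f 0.

Let g_cont : continuous g.
Proof. exact: C1_continuous. Qed.

Let S_closed : closed S.
Proof.
by apply: (continuous_closedP g).1 => //; exact: (@sublevel_closed _ _ f 0).
Qed.

Let bdry_S0 x : bdry S x -> f (g x) = 0%E.
Proof. by move=> /(bdry_preimage_sub g_cont)/bdry_f0. Qed.

Lemma limsup_slope_excess_le (tau : R) :
  0 < tau -> error_bound_with f g xbar tau ->
  (limsup_in (slope_excess f g) (bdry S) xbar <= tau%:E)%E.
Proof.
move=> tau0 /error_bound_withE bound.
have [K K0 g_reg] := metric_regular_near g_cont g_regular.
apply: limsup_in_le; first exact: slope_excess_ge0.
  by rewrite lee_fin ltW.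
apply: filterS (filterI g_reg (near_join bound)) => x [g_regx bound_x].
move=> /bdry_S0 fgx.
exact: (slope_excess_le_of_error_bound
  (g_C1.1 x) K0 g_regx f_convex fgx tau0 bound_x).
Qed.

Lemma error_bound_of_limsup_slope_excess_lt (lam lam' : R) :
  0 < lam -> lam < lam' ->
  (limsup_in (slope_excess f g) (bdry S) xbar < lam%:E)%E ->
  error_bound_with f g xbar lam'.
Proof.
move=> lam0 lam_lt limsup_lt; apply/error_bound_withE.
have lam'0 : 0 < lam' := lt_trans lam0 lam_lt.
have excess_lt :
    \forall z \near xbar, bdry S z -> (slope_excess f g z < lam%:E)%E.
  by apply: limsup_in_lt limsup_lt; exact: slope_excess_ge0.
have [K K0 g_reg] := metric_regular_near g_cont g_regular.
pose theta := (1 - lam / lam') / 2.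
have ratio01 : 0 < lam / lam' < 1 by rewrite divr_gt0 //= ltr_pdivrMr // mul1r.
have theta01 : 0 < theta < 1 by rewrite /theta; lra.
have thetaE : 1 - 2 * theta = lam / lam' by rewrite /theta; lra.
have [theta0 _] := andP theta01.
have [[U V] [/= U_near V_near] correct] :=
  C1_metric_regular_correction g_C1 g_regular theta0.
have z_near : \forall x \near xbar, forall z, `|x - z| <= `|x - xbar| ->
    [/\ V z, metric_regular_with K g z &
      bdry S z -> (slope_excess f g z < lam%:E)%E].
  apply: near_dist_le_center.
  by apply: filterS (filterI V_near (filterI g_reg excess_lt)) => z [? []].
apply: filterS (filterI U_near z_near) => x [Ux near_x].
apply: error_bound_atP => // c c0 fgx.
have x_notin : ~ S x by rewrite /S /sublevel /= fgx lee_fin leNgt c0.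
have [z [bdry_z Sz xz z_dist]] :=
  exists_almost_projection S_closed fxbar x_notin theta01.
have [Vz g_regz /(_ bdry_z) excess_z] := near_x z xz.
have [h dh xzh] := correct (x, z) (conj Ux Vz).
apply: le_trans (edist_le_norm x Sz) _; rewrite lee_fin.
have : (1 - 2 * theta) * `|x - z| <= lam * c.
  have fgx_le : (f (g x) <= c%:E)%E by rewrite fgx.
  apply: (almost_projection_dist_le
    f_convex (bdry_S0 bdry_z) c0 fgx_le excess_z dh xzh).
  by move=> k /(bouligand_preimage (g_C1.1 z) K0 g_regz)/z_dist.
by rewrite thetaE -mulrA ler_pM2l // ler_pdivrMl.
Qed.

Lemma eb_modulusE :
  eb_modulus f g xbar = limsup_in (slope_excess f g) (bdry S) xbar.
Proof.
set L := limsup_in _ _ _; have L0 : (0 <= L)%E.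
  by apply: limsup_in_ge0; exact: slope_excess_ge0.
apply/eqP; rewrite eq_le; apply/andP; split; last first.
  apply: le_ereal_inf_tmp => _ [tau [tau0 bound] <-].
  exact: limsup_slope_excess_le.
case L_l : L L0 => [l| |] // l0; last by rewrite leey.
apply/lee_addgt0Pr => e e0; rewrite lee_fin in l0.
apply: ereal_inf_lbound; exists (l + e) => //; split; first lra.
apply: (@error_bound_of_limsup_slope_excess_lt (l + e / 2)); [lra | lra |].
by rewrite -/L L_l lte_fin; lra.
Qed.

End ErrorBoundModulus.

Theorem theorem4p4 (R : realType) (X Y : completeNormedModType R)
    (g : X -> Y) (f : Y -> \bar R) (xbar : X) :
  C1 g ->
  proper_fun f -> lower_semicontinuous f -> econvex f ->
  bdry [set y | (f y <= 0)%E] `<=` [set y | f y = 0%E] ->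
  (f (g xbar) <= 0)%E ->
  interior (edom f) (g xbar) ->
  metric_regular g xbar ->
  let L := limsup_in
      (fun x => excess [set h | (dplus f (g x) ('d g x h) <= 1)%E]
                       ('d g x @^-1` bouligand [set y | (f y <= 0)%E] (g x)))
      (bdry [set x | (f (g x) <= 0)%E]) xbar in
  (local_error_bound f g xbar <-> (L < +oo)%E) /\ eb_modulus f g xbar = L.
Proof.
move=> g_C1 _ f_lsc f_convex bdry_f0 fxbar _ g_regular L.
have modulusE : eb_modulus f g xbar = L by exact: eb_modulusE.
by split=> //; rewrite -modulusE; exact: local_error_bound_modulus.
Qed.
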